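(* Let $a>0$, let the integer $m$ be defined by $m<a\le m+1$, and let $T\in L(H)$. The following statements are equivalent. (i) $T$ is an $a$-isometry. (ii) $T$ is an $(m+1)$-isometry. (iii) For each vector $h\in H$, there exists a polynomial $p$ of degree at most $m$ such that $\|T^nh\|^2=p(n)$ for every $n\ge0$.
   Context: $H$ is a separable Hilbert space and $L(H)$ is the algebra of bounded linear operators on $H$. For $c>0$, writing $(1-t)^c=\sum_{n\ge0}\alpha_nt^n$, the operator $T$ is a $c$-isometry if the series $\sum_{n=0}^\infty\alpha_nT^{*n}T^n$ converges in the strong operator topology and its sum is $0$. *)

(* Defs.v *)
From HB Require Import structures.
From mathcomp Require Import all_boot all_order all_algebra.
From mathcomp Require Import all_classical all_reals all_analysis.
From mathcomp Require Import complex.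

Set Implicit Arguments.
Unset Strict Implicit.
Unset Printing Implicit Defensive.

Import Order.TTheory GRing.Theory Num.Theory.
Import numFieldNormedType.Exports.

Local Open Scope classical_set_scope.
Local Open Scope ring_scope.
Local Open Scope complex_scope.

(* A complex Hilbert space is a complete normed space H over R[i] together    *)
(* with a form ip : {dot H for Num.conj} (sesquilinear, linear in the first   *)
(* argument, hermitian and positive definite) inducing the norm of H.         *)
Definition induces_norm (R : realType) (H : normedModType R[i])
    (ip : {dot H for (@Num.conj R[i])}) : Prop :=
  forall x : H, ip x x = `|x| ^+ 2.

Definition separable_space (X : topologicalType) : Prop :=
  exists2 D : set X, countable D & dense D.

(* adjoint ip T y is the vector z such that <T x, y> = <x, z> for all x.      *)
(* Positive definiteness makes it unique; it exists by the Riesz theorem when *)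
(* T is a bounded operator on a Hilbert space. The default value 0 only       *)
(* serves to make the definition total.                                       *)
Definition adjoint (R : realType) (H : normedModType R[i])
    (ip : {dot H for (@Num.conj R[i])}) (T : H -> H) : H -> H :=
  fun y => xget 0 [set z | forall x, ip (T x) y = ip x z].

Definition sot_cvg (R : realType) (H : normedModType R[i])
    (S : nat -> H -> H) (L : H -> H) : Prop :=
  forall h : H, (S n h @[n --> \oo]) --> L h.

(* alpha is the (unique) sequence with (1 - t)^c = \sum_n alpha_n t^n.        *)
Definition binomial_expansion (R : realType) (c : R) (alpha : nat -> R)
    : Prop :=
  forall t : R, `|t| < 1 ->
    (\sum_(0 <= n < N) alpha n * t ^+ n @[N --> \oo]) --> (1 - t) `^ c.

Definition isometry_of_order (R : realType) (H : normedModType R[i])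
    (ip : {dot H for (@Num.conj R[i])}) (c : R) (T : H -> H) : Prop :=
  exists2 alpha : nat -> R, binomial_expansion c alpha &
    sot_cvg
      (fun N h => \sum_(0 <= n < N)
         (alpha n)%:C *: iter n (adjoint ip T) (iter n T h))
      (fun=> 0).

(* Main.v *)
Require Import Defs.
From HB Require Import structures.
From mathcomp Require Import all_boot all_order all_algebra.
From mathcomp Require Import all_classical all_reals all_analysis.
From mathcomp Require Import complex.
From mathcomp Require Import ring lra zify.

Set Implicit Arguments.
Unset Strict Implicit.
Unset Printing Implicit Defensive.

Import Order.TTheory GRing.Theory Num.Theory.
Import numFieldNormedType.Exports.

Local Open Scope classical_set_scope.
Local Open Scope ring_scope.
Local Open Scope complex_scope.

(* Let (1 - t)^a = sum_n alpha_n t^n, let S be the shift on sequences and put  *)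
(* x_n = |T^n h|^2. Pairing the series with h shows that (i) gives             *)
(* (1 - S)^a x = 0 for every h. If a = m + 1 this says that the (m+1)-st       *)
(* difference of x vanishes. Otherwise multiply by (1 - S)^c with              *)
(* c = 2m + 2 - a > a, where (1 - t)^c = sum_n gamma_n t^n. In the convolution *)
(* of gamma and alpha the terms gamma_j alpha_(l-j) have constant sign away    *)
(* from both ends, which bounds the sum of their absolute values by a multiple *)
(* of |alpha_l|. As sum_l |alpha_l| x_l converges, the rearrangement is        *)
(* legitimate and (1 - S)^(2m+2) x = 0, so x is a polynomial. Its degree goes  *)
(* down to at most m because sum_(k < N) alpha_k C(k, j) equals                *)
(* alpha_j prod_(1 <= i <= N-j-1) (1 - (a - j) / i), which tends to 0 for      *)
(* j < a and not for j = m + 1 > a.                                            *)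
(* Conversely, polarization turns the vanishing of the (m+1)-st differences of *)
(* all sequences |T^n h|^2 into that of the vectors T*^n T^n h. Newton's       *)
(* formula then writes the partial sums of the operator series at h as         *)
(* combinations of m + 1 fixed vectors, whose coefficients tend to 0.          *)

(** * Finite differences *)

(** All three statements are compared with one condition: for every h, the (m+1)-st differences of
    |T^n h|^2 vanish. [isometry_fdiff] and [fdiff_isometry] tie it to isometries of any order in ]m,
    m+1], which covers both a and m + 1; [fdiff_poly] and [fdiff_horner_eq0] tie it to polynomials.

    The core is [gbin_annihilated]: [gbin_annihilated_nat], resting on [gbin_conv_bound], kills the
    differences of order 2m + 2, and [gbin_annihilated_lower] brings the order down to m + 1. The
    coefficients are identified by [binomial_expansion_gbin] and [binomial_expansion_uniq], and
    [riesz_real] gives the adjoint. *)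

Definition fdiff (V : zmodType) (u : nat -> V) (n : nat) : V := u n.+1 - u n.

Lemma morph_iter_fdiff (V W : zmodType) (f : V -> W) (u : nat -> V) k n :
  {morph f : x y / x - y} ->
  iter k (@fdiff W) (fun i => f (u i)) n = f (iter k (@fdiff V) u n).
Proof. by move=> fB; elim: k n => [//|k IH] n; rewrite !iterS /fdiff !IH fB. Qed.

Lemma iter_fdiff_shift (V : zmodType) (u : nat -> V) k n i :
  iter k (@fdiff V) (fun j => u (n + j)%N) i = iter k (@fdiff V) u (n + i)%N.
Proof. by elim: k i => [//|k IH] i; rewrite !iterS /fdiff !IH addnS. Qed.

Lemma iter_fdiff_eq0 (V : zmodType) (u : nat -> V) d k n :
  (d <= k)%N -> (forall i, iter d (@fdiff V) u i = 0) ->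
  iter k (@fdiff V) u n = 0.
Proof.
move=> /subnK <- ud0; rewrite iterD.
have -> : iter d (@fdiff V) u = fun=> 0 by apply/funext.
by elim: (k - d)%N n => [//|j IH] n; rewrite iterS /fdiff !IH subrr.
Qed.

(** With D the difference operator, the shift is 1 + D and its n-th power expands by the binomial
    theorem. The induction applies the hypothesis to u and to [fdiff u], then merges by Pascal's
    rule. *)
Lemma newton_fdiff (V : zmodType) (u : nat -> V) n :
  u n = \sum_(j < n.+1) iter j (@fdiff V) u 0%N *+ 'C(n, j).
Proof.
elim: n u => [|n IH] u; first by rewrite big_ord1 bin0.
have -> : u n.+1 = u n + fdiff u n by rewrite addrC subrK.
rewrite {1}(IH u) (IH (fdiff u)) [RHS]big_ord_recl [X in X + _ = _]big_ord_recl !bin0.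
under [in RHS]eq_bigr => j _ do rewrite /bump binS mulrnDr.
rewrite big_split /= [X in _ = _ + (X + _)]big_ord_recr /= bin_small// mulr0n addr0.
rewrite -addrA; congr (_ + (_ + _)).
by apply: eq_bigr => j _; rewrite -iterS iterSr.
Qed.

Lemma newton_fdiff_trunc (V : zmodType) (u : nat -> V) d n :
  (forall i, iter d (@fdiff V) u i = 0) ->
  u n = \sum_(j < d) iter j (@fdiff V) u 0%N *+ 'C(n, j).
Proof.
move=> ud0; rewrite newton_fdiff.
pose F j := iter j (@fdiff V) u 0%N *+ 'C(n, j).
(* Terms with j > n vanish through the binomial, those with j >= d through the difference, so both
   cutoffs extend to the common one n + 1 + d. *)
have ext N : (n < N)%N || (d <= N)%N -> forall M, (N <= M)%N ->
    \sum_(0 <= j < M) F j = \sum_(0 <= j < N) F j.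
  move=> hN M NM; rewrite (big_cat_nat (leq0n N) NM) /=.
  rewrite [X in _ + X]big_nat [X in _ + X]big1 ?addr0// => j /andP[Nj _].
  rewrite /F; case/orP: hN => h; first by rewrite bin_small ?mulr0n// (leq_trans h).
  by rewrite (@iter_fdiff_eq0 _ _ d)// ?mul0rn// (leq_trans h).
rewrite -(big_mkord xpredT F) -(big_mkord xpredT F).
rewrite -(ext n.+1 _ (n.+1 + d)%N) ?ltnSn ?leq_addr//.
by rewrite (ext d)// ?leq_addl// leqnn orbT.
Qed.

(** Leibniz rule for multiplication by the index; it drives the induction on the degree in
    [fdiff_horner_eq0]. *)
Lemma iter_fdiff_natmul (R : comPzRingType) (u : nat -> R) k n :
  iter k.+1 (@fdiff R) (fun i => u i * i%:R) n =
  iter k.+1 (@fdiff R) u n * n%:R + iter k (@fdiff R) u n.+1 *+ k.+1.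
Proof.
elim: k n => [|k IH] n; first by rewrite /= /fdiff -natr1 mulrDr mulr1 mulrBl addrAC.
rewrite iterS {1}/fdiff !IH.
set w := iter k (@fdiff R) u.
have -> : iter k.+2 (@fdiff R) u n = w n.+2 - w n.+1 - (w n.+1 - w n) by [].
have E j : iter k.+1 (@fdiff R) u j = w j.+1 - w j by [].
rewrite !E -(natr1 n) -[(w n.+2 - w n.+1) *+ k.+2]mulr_natr -(natr1 k.+1).
rewrite -[w n.+2 *+ k.+1]mulr_natr -[w n.+1 *+ k.+1]mulr_natr.
ring.
Qed.

Lemma fdiff_horner_eq0 (R : comNzRingType) (p : {poly R}) d n :
  (size p <= d)%N -> iter d (@fdiff R) (fun i => p.[i%:R]) n = 0.
Proof.
elim/poly_ind: p d n => [|p c IH] d n.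
  move=> _; apply: (@iter_fdiff_eq0 _ _ 0%N) => // i.
  by rewrite /= horner0.
rewrite size_MXaddC; case: ifP => [/andP[/eqP -> /eqP ->] _|_].
  apply: (@iter_fdiff_eq0 _ _ 0%N) => // i.
  by rewrite /= mul0r add0r hornerC.
case: d => // d; rewrite ltnS => pd.
have -> : (fun i : nat => (p * 'X + c%:P).[i%:R]) =
    (fun i => p.[i%:R] * i%:R + c) by apply/funext => i; rewrite hornerMXaddC.
have -> : iter d.+1 (@fdiff R) (fun i => p.[i%:R] * i%:R + c) n =
    iter d.+1 (@fdiff R) (fun i => p.[i%:R] * i%:R) n.
  rewrite !iterSr; congr (iter _ _ _ _); apply/funext => i.
  by rewrite /fdiff opprD addrACA subrr addr0.
rewrite iter_fdiff_natmul iterS {1}/fdiff !IH// ?leqnSn//.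
by rewrite subrr mul0r mul0rn addr0.
Qed.

Lemma fdiff_poly (R : numFieldType) (u : nat -> R) d :
  (forall i, iter d (@fdiff R) u i = 0) ->
  exists p : {poly R}, (size p <= d)%N /\ forall n, u n = p.[n%:R].
Proof.
move=> ud0.
(* The falling factorial X (X - 1) ... (X - j + 1), whose value at n is j! 'C(n, j), turns Newton's
   formula into a polynomial. *)
pose b j : {poly R} := \prod_(i < j) ('X - (i%:R)%:P).
exists (\sum_(j < d) (iter j (@fdiff R) u 0%N / j`!%:R) *: b j); split.
  apply: leq_trans (size_sum _ _ _) _; apply/bigmax_leqP => j _.
  apply: leq_trans (size_scale_leq _ _) _.
  by rewrite size_prod_XsubC /index_enum -enumT size_enum_ord.
move=> n; rewrite (newton_fdiff_trunc _ ud0) horner_sum; apply: eq_bigr => j _.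
have bE k : (b k).[n%:R] = (n ^_ k)%:R.
  elim: k => [|k IH]; first by rewrite /b big_ord0 hornerC ffactn0.
  rewrite /b big_ord_recr hornerM IH ffactnSr natrM hornerXsubC.
  have [kn|nk] := leqP k n; first by rewrite natrB.
  by rewrite ffact_small ?mul0r.
rewrite hornerZ bE -bin_ffact natrM -[LHS]mulr_natr mulrA mulrAC.
by rewrite divfK ?pnatr_eq0 -?lt0n ?fact_gt0.
Qed.

(** * Generalized binomial coefficients *)

(* gbin a n = (-1)^n C(a, n) is the coefficient of t^n in (1 - t)^a. *)
Definition gbin (F : fieldType) (a : F) (n : nat) : F :=
  \prod_(i < n) ((i%:R - a) / i.+1%:R).

Section GbinAlgebra.
Variable F : numFieldType.
Implicit Types a c : F.

Lemma gbin0 a : gbin a 0 = 1. Proof. exact: big_ord0. Qed.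

Lemma gbinS a n : gbin a n.+1 = gbin a n * ((n%:R - a) / n.+1%:R).
Proof. exact: big_ord_recr. Qed.

Lemma gbinSr a n : n.+1%:R * gbin a n.+1 = (n%:R - a) * gbin a n.
Proof. by rewrite gbinS [_ / _]mulrC mulrCA mulVKf ?pnatr_eq0// mulrC. Qed.

Lemma gbin_pascal a n : gbin (a + 1) n.+1 = gbin a n.+1 - gbin a n.
Proof.
elim: n => [|n IH]; first by rewrite !gbinS !gbin0; field.
rewrite gbinS IH !gbinS -(natr1 n.+1) -(natr1 n); field.
by rewrite !natr1 !pnatr_eq0.
Qed.

(** Taking partial sums divides the generating function (1 - t)^a by 1 - t. *)
Lemma sum_gbin a n : \sum_(0 <= i < n.+1) gbin a i = gbin (a - 1) n.
Proof.
elim: n => [|n IH]; first by rewrite big_nat1 !gbin0.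
rewrite big_nat_recr //= IH -{2}(subrK 1 a) gbin_pascal; ring.
Qed.

Lemma gbin_nat_eq0 d n : (d < n)%N -> gbin d%:R n = 0 :> F.
Proof.
by move=> dn; rewrite /gbin (bigD1 (Ordinal dn))//= subrr mul0r mul0r.
Qed.

(* Both sides v satisfy (n + 1) v_(n+1) = (n - c - a) v_n. *)
Lemma gbin_conv c a n :
  \sum_(0 <= j < n.+1) gbin c j * gbin a (n - j) = gbin (c + a) n.
Proof.
elim: n => [|n IH]; first by rewrite big_nat1 !gbin0 mul1r.
apply: (@mulfI _ n.+1%:R); first by rewrite pnatr_eq0.
rewrite gbinSr -IH !mulr_sumr.
have -> : \sum_(0 <= j < n.+2) n.+1%:R * (gbin c j * gbin a (n.+1 - j)) =
   \sum_(0 <= j < n.+2) (j%:R * gbin c j) * gbin a (n.+1 - j) +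
   \sum_(0 <= j < n.+2) gbin c j * ((n.+1 - j)%:R * gbin a (n.+1 - j)).
  rewrite -big_split !big_mkord; apply: eq_bigr => j _ /=.
  by rewrite natrB -1?ltnS //; ring.
rewrite big_nat_recl// mul0r mul0r add0r.
rewrite [X in _ + X]big_nat_recr //= subnn mul0r mulr0 addr0 -big_split.
rewrite !big_mkord; apply: eq_bigr => j _ /=.
rewrite gbinSr subSS subSn -1?ltnS// gbinSr natrB -1?ltnS//; ring.
Qed.

Lemma gbin_mul_bin a j i :
  gbin a (j + i) * 'C(j + i, j)%:R = gbin a j * gbin (a - j%:R) i.
Proof.
elim: i => [|i IH]; first by rewrite addn0 binn gbin0.
rewrite addnS !gbinS.
have h : 'C((j + i).+1, j)%:R = (j + i).+1%:R * 'C(j + i, j)%:R / i.+1%:R :> F.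
  apply: (canRL (mulfK _)); first by rewrite pnatr_eq0.
  by rewrite -!natrM mulnC mul_bin_down -addnS addKn.
rewrite h [RHS]mulrA -IH.
have := pnatr_eq0 F (j + i).+1; rewrite -(natr1 i) -natr1 natrD => /negbT n0.
by field; rewrite n0 natr1 pnatr_eq0.
Qed.

(** Terms with k < j vanish; for k = j + i the product formula [gbin_mul_bin] reduces the sum to
    [sum_gbin]. *)
Lemma sum_gbin_bin a j n :
  \sum_(0 <= k < j + n.+1) gbin a k * 'C(k, j)%:R =
  gbin a j * gbin (a - j%:R - 1) n.
Proof.
rewrite (big_cat_nat (leq0n j)) ?leq_addr//= big_nat.
rewrite big1 ?add0r => [|k /andP[_ kj]]; last first.
  by rewrite bin_small ?mulr0.
rewrite -{1}[j]add0n big_addn addKn -sum_gbin mulr_sumr.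
by apply: eq_bigr => i _; rewrite addnC gbin_mul_bin.
Qed.

Lemma sum_gbin_newton a (u : nat -> F) d N :
  (forall i, iter d (@fdiff F) u i = 0) ->
  \sum_(0 <= k < N) gbin a k * u k =
  \sum_(j < d) iter j (@fdiff F) u 0%N *
    \sum_(0 <= k < N) gbin a k * 'C(k, j)%:R.
Proof.
move=> ud0; under eq_bigr => k _ do rewrite (newton_fdiff_trunc _ ud0) mulr_sumr.
rewrite exchange_big /=; apply: eq_bigr => j _; rewrite mulr_sumr.
by apply: eq_bigr => k _; rewrite -(mulr_natr (iter _ _ _ _)) mulrCA.
Qed.

(** For a natural exponent the series is finite: it is (1 - S)^d with S the shift, and d < N covers
    all its coefficients. *)
Lemma sum_gbin_nat d N (u : nat -> F) : (d < N)%N ->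
  \sum_(0 <= k < N) gbin d%:R k * u k = (-1) ^+ d * iter d (@fdiff F) u 0%N.
Proof.
case: N => // N; elim: d N u => [|d IH] N u dN.
  rewrite big_nat_recl// gbin0 big_nat big1 ?addr0// => k _.
  by rewrite gbin_nat_eq0 ?mul0r.
rewrite big_nat_recl// gbin0 -natr1.
under eq_bigr => k _ do rewrite gbin_pascal mulrBl.
rewrite sumrB addrA -[X in X * u 0%N](gbin0 d%:R).
rewrite -(big_nat_recl N 0 (fun k => gbin d%:R k * u k))//.
case: N dN => // N dN; have /= IHS := IH N (fun k => u k.+1).
rewrite IH; last exact: leqW.
rewrite IHS//.
rewrite (iter_fdiff_shift u d 1 0 : iter _ _ (fun k => u k.+1) _ = _).
by rewrite -mulrBr /fdiff exprS mulN1r mulNr -mulrN opprB.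
Qed.

End GbinAlgebra.

Lemma cvg_ext (V : topologicalType) (f g : nat -> V) (l : V) :
  f =1 g -> (f n @[n --> \oo]) --> l -> (g n @[n --> \oo]) --> l.
Proof. by move=> /funext ->. Qed.

(** * Decay, growth and radius of convergence of the binomial coefficients *)

Section GbinAnalysis.
Variable R : realType.
Implicit Types a b c t : R.

(** The factors of [gbin (b - 1)] are 1 - b / (i + 1), and the harmonic series diverges. *)
Lemma cvg_gbin_0 b : 0 < b -> (gbin (b - 1) n @[n --> \oo]) --> (0 : R).
Proof.
move=> b0; pose P := gbin (b - 1); pose n0 := Num.bound b.
pose H n : R := series harmonic n.
(* Past n0 > b the factors are 1 - t with 0 <= t <= 1, and (1 - t) (1 + s + t) <= 1 + s for s >=
   0. *)
have key k : `|P (n0 + k)%N| * (1 + b * (H (n0 + k)%N - H n0)) <= `|P n0|.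
  elim: k => [|k IH]; first by rewrite addn0 subrr mulr0 addr0 mulr1.
  apply: le_trans IH; rewrite addnS /P gbinS normrM -mulrA ler_wpM2l//.
  rewrite /H [series harmonic _.+1]seriesSr /=.
  have n1 : 0 < (n0 + k).+1%:R :> R by rewrite ltr0n.
  set q := H _ - H n0; set i := (n0 + k).+1%:R in n1 *.
  have q0 : 0 <= q.
    rewrite subr_ge0; apply: (nondecreasing_seqP _).1; last exact: leq_addr.
    by move=> j; rewrite /H seriesSr lerDl invr_ge0.
  have bi : b < i.
    apply: lt_le_trans (archi_boundP (ltW b0)) _.
    by rewrite /i ler_nat leqW ?leq_addr.
  pose t := b / i.
  have t0 : 0 <= t by rewrite divr_ge0// ltW.
  have t1 : t <= 1 by rewrite ler_pdivrMr// mul1r ltW.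
  have -> : ((n0 + k)%:R - (b - 1)) / i = 1 - t.
    have iE : i = (n0 + k)%:R + 1 by rewrite natr1.
    by rewrite -[1 in RHS](divff (lt0r_neq0 n1)) -mulrBl; congr (_ / _); rewrite iE; ring.
  rewrite ger0_norm ?subr_ge0//.
  have -> : b * (H (n0 + k)%N + i^-1 - H n0) = b * q + t by rewrite /q /t; ring.
  have : 0 <= b * q by rewrite mulr_ge0// ltW.
  rewrite -/q; nra.
have Hoo : H n @[n --> \oo] --> +oo.
  apply: nondecreasing_dvgn_lt; last exact: dvg_harmonic.
  by apply/nondecreasing_seqP => j; rewrite /H seriesSr lerDl invr_ge0.
apply/cvgrPdist_lt => e e0; near=> n.
rewrite sub0r normrN -/P.
have n0n : (n0 <= n)%N by near: n; exact: nbhs_infty_ge.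
have := key (n - n0)%N; rewrite subnKC// => Pn.
have Hn : `|P n0| / e / b + H n0 <= H n.
  by near: n; move/cvgryPge: Hoo; exact.
have : `|P n0| / e <= b * (H n - H n0).
  by move: Hn; rewrite -lerBrDr ler_pdivrMr// (mulrC b).
rewrite ler_pdivrMr// => h.
rewrite -(@ltr_pM2r _ (1 + b * (H n - H n0))); last first.
  have : 0 <= `|P n0| by [].
  nra.
apply: le_lt_trans Pn _; nra.
Unshelve. all: by end_near. Qed.

Lemma norm_gbin_ge1 b n : b <= 0 -> 1 <= `|gbin (b - 1) n|.
Proof.
move=> b0; elim: n => [|n IH]; first by rewrite gbin0 normr1.
have h : 1 <= (n%:R - (b - 1)) / n.+1%:R.
  by rewrite ler_pdivlMr ?ltr0n// -natr1; lra.
rewrite gbinS normrM; apply: mulr_ege1 => //.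
exact: le_trans h (ler_norm _).
Qed.

(** For |t| < r < 1, [|gbin c n| * r ^+ n] eventually decreases because the ratio of coefficients
    tends to 1; hence it is bounded and a geometric series of ratio |t| / r dominates. *)
Lemma is_cvg_pseries_gbin c t : `|t| < 1 -> cvgn (pseries (gbin c) t).
Proof.
move=> t1; pose r := (`|t| + 1) / 2.
have tr : `|t| < r by rewrite /r; lra.
have r1 : r < 1 by rewrite /r; lra.
have r0 : 0 < r by apply: le_lt_trans tr.
have [M hM] : exists M, forall n, `|gbin c n| * r ^+ n <= M.
  pose n0 := Num.bound (`|c| / (1 - r)).
  have step n : (n0 <= n)%N ->
      `|gbin c n.+1| * r ^+ n.+1 <= `|gbin c n| * r ^+ n.
    move=> n0n; rewrite gbinS normrM exprSr -mulrA ler_wpM2l//.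
    rewrite mulrCA ler_piMr ?exprn_ge0// ?(ltW r0)// normrM normfV.
    rewrite [`|n.+1%:R|]ger0_norm// mulrAC ler_pdivrMr// mul1r.
    have cn : `|c| <= n%:R * (1 - r).
      rewrite -ler_pdivrMr ?subr_gt0//; apply: ltW.
      have h : 0 <= `|c| / (1 - r) by rewrite divr_ge0// subr_ge0 ltW.
      by apply: lt_le_trans (archi_boundP h) _; rewrite ler_nat.
    have := ler_normB n%:R c; rewrite [`|n%:R|]ger0_norm// -natr1.
    have := normr_ge0 c; nra.
  exists (\sum_(i < n0.+1) `|gbin c i| * r ^+ i) => n.
  have ge0 i : 0 <= `|gbin c i| * r ^+ i by rewrite mulr_ge0// exprn_ge0// ltW.
  have small k : (k <= n0)%N ->
      `|gbin c k| * r ^+ k <= \sum_(i < n0.+1) `|gbin c i| * r ^+ i.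
    move=> kn0; rewrite (bigD1 (Ordinal (kn0 : k < n0.+1)%N))//= lerDl.
    by rewrite sumr_ge0.
  have [/small//|n0n] := leqP n n0.
  rewrite -(subnKC (ltnW n0n)); elim: (n - n0)%N => [|k IH]; first by rewrite addn0 small.
  by apply: le_trans IH; rewrite addnS step// leq_addr.
apply: normed_cvg; rewrite /= /pseries.
apply: (@series_le_cvg _ _ (geometric M (`|t| / r))).
- by move=> n; exact: normr_ge0.
- have M0 : 0 <= M.
    by apply: le_trans (hM 0%N); rewrite mulr_ge0// exprn_ge0// ltW.
  by move=> n; rewrite /geometric /= mulr_ge0// exprn_ge0// divr_ge0// ltW.
- move=> n; rewrite /geometric /= normrM normrX expr_div_n.
  rewrite mulrCA mulrA ler_pdivlMr ?exprn_gt0//.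
  by rewrite mulrAC [leRHS]mulrC ler_wpM2r ?exprn_ge0.
apply: is_cvg_geometric_series.
by rewrite ger0_norm ?divr_ge0 ?(ltW r0)// ltr_pdivrMr// mul1r.
Qed.

End GbinAnalysis.

(** * The binomial theorem for real exponents and uniqueness of its coefficients *)

Section BinomialSeries.
Variable R : realType.
Implicit Types a c t : R.

Let F c t := limn (pseries (gbin c) t).

Lemma pseries_diffs_gbin c :
  pseries_diffs (gbin c) = (fun n => - c * gbin (c - 1) n) :> (nat -> R).
Proof.
apply/funext => n; rewrite /pseries_diffs.
elim: n => [|n IH]; first by rewrite gbinS !gbin0; field.
apply: (@mulfI _ n.+1%:R); first by rewrite pnatr_eq0.
rewrite gbinSr mulrCA IH [RHS]mulrCA gbinSr -natr1; ring.
Qed.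

Let pseriesZ c k t :
  pseries (fun n => k * gbin c n) t = k *: pseries (gbin c) t.
Proof.
apply/funext => N; rewrite /pseries /series /=.
transitivity (k * \sum_(0 <= i < N) gbin c i * t ^+ i) => //.
rewrite mulr_sumr; by apply: eq_bigr => i _; rewrite mulrA.
Qed.

Let is_cvg_pseriesZ c k t : `|t| < 1 ->
  cvgn (pseries (fun n => k * gbin c n) t).
Proof.
by move=> t1; rewrite pseriesZ; apply: is_cvgZl_tmp; exact: is_cvg_pseries_gbin.
Qed.

Let is_derive_F c t : `|t| < 1 -> is_derive t (1 : R) (F c) (- c * F (c - 1) t).
Proof.
(* Termwise differentiation at t asks for convergence of the series and of its first two formal
   derivatives at some K with |t| < |K|. *)
move=> t1; pose K := (`|t| + 1) / 2.
have K0 : 0 <= K by rewrite /K; have := normr_ge0 t; lra.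
have tK : `|t| < `|K| by rewrite (ger0_norm K0) /K; lra.
have K1 : `|K| < 1 by rewrite (ger0_norm K0) /K; lra.
have dd : pseries_diffs (pseries_diffs (gbin c)) =
    fun n => (- c * - (c - 1)) * gbin (c - 1 - 1) n.
  rewrite pseries_diffs_gbin; apply/funext => n.
  rewrite /pseries_diffs mulrCA -/(pseries_diffs (gbin (c - 1)) n).
  by rewrite pseries_diffs_gbin mulrA.
have := @pseries_snd_diffs R (gbin c) K t (is_cvg_pseries_gbin K1).
rewrite dd pseries_diffs_gbin => /(_ (is_cvg_pseriesZ K1)).
move=> /(_ (is_cvg_pseriesZ K1) tK).
by rewrite pseriesZ limZl_tmp//; exact: is_cvg_pseries_gbin.
Qed.

Let F_rec c t : `|t| < 1 -> (1 - t) * F (c - 1) t = F c t.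
Proof.
move=> t1; have C1 : cvgn (pseries (gbin (c - 1)) t) by exact: is_cvg_pseries_gbin.
apply/esym/cvg_lim => //; rewrite -cvg_shiftS /=.
have -> : (fun N => pseries (gbin c) t N.+1) =
    (fun N => (1 - t) * pseries (gbin (c - 1)) t N.+1 +
       t * (gbin (c - 1) N * t ^+ N)).
  apply/funext => N; rewrite /pseries /series /=.
  elim: N => [|N IH]; first by rewrite !big_nat1 !gbin0 expr0; ring.
  rewrite big_nat_recr //= IH [in RHS]big_nat_recr //=.
  have -> : gbin c N.+1 = gbin (c - 1) N.+1 - gbin (c - 1) N.
    by rewrite -gbin_pascal subrK.
  rewrite exprS; ring.
rewrite -[(1 - t) * _]addr0; apply: cvgD.
  by apply: cvgMl_tmp; rewrite cvg_shiftS.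
rewrite -(mulr0 t); apply: cvgMl_tmp.
exact: cvg_series_cvg_0 C1.
Qed.

Lemma binomial_expansion_gbin a : binomial_expansion a (gbin a).
Proof.
move=> t t1.
have lim1 : (1 - t) `^ a = F a t.
  (* G has derivative 0 on ]-1, 1[ and value 1 at 0, so the sum of the series is (1 - s)^a. *)
  pose G s := F a s * (1 - s) `^ (- a).
  have dG (s : R) : `|s| < 1 -> is_derive s (1 : R) G (0 : R).
    move=> s1; have s0 : 0 < 1 - s by have := ler_norm s; lra.
    have d1 : is_derive s (1 : R) (fun s : R => 1 - s) (-1 : R).
      by apply: is_derive_eq; rewrite add0r mul1r.
    have d2 := @is_derive1_comp R (@powR R ^~ (- a)) (fun s : R => 1 - s) s _ _
      (is_derive1_powR (- a) s0) d1.
    have d3 := is_deriveM (is_derive_F a s1) d2.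
    apply: (is_derive_eq d3).
    rewrite /= -(F_rec a s1).
    have -> : (1 - s) `^ (- a) = (1 - s) * (1 - s) `^ (- a - 1).
      rewrite -[X in _ = X * _](powRr1 (ltW s0)) -powRD ?subrKC//.
      by apply/implyP => _; rewrite gt_eqF.
    rewrite /GRing.scale /=; ring.
  have cG s : `|s| < 1 -> G s = G 0.
    move=> s1; have [s0|s0] := leP 0 s.
      have in1 x : x \in `[0, s] -> `|x| < 1.
        rewrite in_itv/= => /andP[x0 xs]; rewrite ger0_norm//.
        by rewrite (le_lt_trans (le_trans xs (ler_norm _))).
      have [||x _] := @MVT_segment R G (fun=> 0) 0 s s0.
      - by move=> x /subset_itv_oo_cc xs; exact/dG/in1.
      - by apply: derivable_within_continuous => x /in1/dG[].
      by rewrite mul0r => /eqP; rewrite subr_eq0 => /eqP.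
    have in1 x : x \in `[s, 0] -> `|x| < 1.
      rewrite in_itv/= => /andP[x0 xs]; rewrite ler0_norm//.
      by apply: le_lt_trans s1; rewrite ltr0_norm// lerN2.
    have [||x _] := @MVT_segment R G (fun=> 0) s 0 (ltW s0).
    - by move=> x /subset_itv_oo_cc xs; exact/dG/in1.
    - by apply: derivable_within_continuous => x /in1/dG[].
    by rewrite mul0r => /eqP; rewrite subr_eq0 => /eqP.
  have F0 : F a 0 = 1.
    apply: cvg_lim => //; rewrite -cvg_shiftS /=.
    have -> : (fun N => pseries (gbin a) 0 N.+1) = fun=> 1; last exact: cvg_cst.
    apply/funext => N; rewrite /pseries /series /= big_nat_recl// big1 ?addr0.
      by rewrite gbin0 expr0 mulr1.
    by move=> i _; rewrite expr0n mulr0.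
  have := cG _ t1; rewrite /G F0 subr0 powR1 mulr1 powRN => /(canRL (mulfK _)).
  rewrite invrK mul1r => -> //.
  by rewrite invr_eq0 gt_eqF// powR_gt0//; have := ler_norm t; lra.
rewrite lim1; exact: is_cvg_pseries_gbin.
Qed.

(** If d = u - v vanishes below k, then |d_k| t^k is at most a constant times t^(k+1) for small t >
    0, and t -> 0 gives d_k = 0. This replaces the unspecified coefficients of [isometry_of_order]
    by [gbin]. *)
Lemma binomial_expansion_uniq a (u v : nat -> R) :
  binomial_expansion a u -> binomial_expansion a v -> u = v.
Proof.
move=> hu hv; apply/funext => n; apply/eqP; rewrite -subr_eq0; apply/eqP.
pose d n := u n - v n; rewrite -/(d n).
have dcvg t : `|t| < 1 -> \sum_(0 <= n < N) d n * t ^+ n @[N --> \oo] --> (0 : R).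
  move=> t1; suff : \sum_(0 <= n < N) d n * t ^+ n @[N --> \oo] -->
      ((1 - t) `^ a - (1 - t) `^ a) by rewrite subrr.
  apply: (cvg_ext _ (cvgB (hu _ t1) (hv _ t1))) => N.
  transitivity (\sum_(0 <= n < N) u n * t ^+ n - \sum_(0 <= n < N) v n * t ^+ n) => //.
  by rewrite -sumrB; apply: eq_bigr => i _; rewrite mulrBl.
(* The terms of the series at t = 1/2 are bounded. *)
have [M M0 hM] : exists2 M, 0 <= M & forall n, `|d n| <= M * 2 ^+ n.
  have h2 : `|2^-1 : R| < 1 by rewrite ger0_norm// invf_lt1// ltr1n.
  have : cvgn (series (fun n => d n * 2^-1 ^+ n)) by apply/cvg_ex; exists 0; exact: dcvg.
  move=> /cvg_series_bounded [B [_ hB]].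
  exists (`|B| + 1) => // k.
  have B1 : B < `|B| + 1 by rewrite (le_lt_trans (ler_norm B)) ?ltrDl.
  have : `|d k * 2^-1 ^+ k| <= `|B| + 1 by exact: hB B1 k I.
  by rewrite normrM normrX [`|2^-1|]ger0_norm// exprVn ler_pdivrMr ?exprn_gt0.
elim/ltn_ind: n => k IH.
have bound t : 0 < t -> t <= 4^-1 -> `|d k| <= (M * 2 ^+ k.+2) * t.
  move=> t0 t4.
  have t1 : `|t| < 1 by rewrite gtr0_norm//; lra.
  have lim : `|\sum_(0 <= n < N) d n * t ^+ n| @[N --> \oo] --> (0 : R).
    suff : `|\sum_(0 <= n < N) d n * t ^+ n| @[N --> \oo] --> `|0 : R| by rewrite normr0.
    exact: cvg_norm (dcvg _ t1).
  have part j : `|d k| * t ^+ k - (M * 2 ^+ k.+2) * t ^+ k.+1 <=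
      `|\sum_(0 <= n < k.+1 + j) d n * t ^+ n|.
    (* The geometric ratio 2t is at most 1/2; the subtracted power of 2t makes the bound inductive
       in j. *)
    have tail : `|\sum_(k.+1 <= n < k.+1 + j) d n * t ^+ n| <=
        M * (2 * t) ^+ k.+1 * (2 - 2 * (2 * t) ^+ j).
      elim: j => [|j IHj].
        by rewrite addn0 big_geq// normr0 expr0 mulr1 subrr mulr0.
      rewrite addnS big_nat_recr ?leq_addr//=.
      apply: le_trans (ler_normD _ _) _; apply: le_trans (lerD IHj (lexx _)) _.
      rewrite -lerBrDl -mulrBr normrM [`|t ^+ _|]ger0_norm ?exprn_ge0 ?(ltW t0)//.
      apply: (@le_trans _ _ (M * (2 * t) ^+ (k.+1 + j))).
        by rewrite exprMn mulrA ler_wpM2r ?exprn_ge0 ?(ltW t0).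
      rewrite exprD -mulrA ler_wpM2l// ler_wpM2l ?exprn_ge0 ?mulr_ge0 ?(ltW t0)//.
      rewrite exprS; have : 0 <= (2 * t) ^+ j by rewrite exprn_ge0 ?mulr_ge0 ?(ltW t0).
      nra.
    rewrite (big_cat_nat (leq0n k.+1)) ?leq_addr//= big_nat_recr//=.
    rewrite big_nat big1 ?add0r; last first.
      by move=> i /andP[_ ik]; rewrite IH ?mul0r.
    have T : `|\sum_(k.+1 <= n < k.+1 + j) d n * t ^+ n| <= M * 2 ^+ k.+2 * t ^+ k.+1.
      apply: le_trans tail _.
      have -> : M * 2 ^+ k.+2 * t ^+ k.+1 = M * (2 * t) ^+ k.+1 * 2.
        by rewrite exprMn [2 ^+ k.+2]exprS; ring.
      rewrite ler_wpM2l ?mulr_ge0 ?exprn_ge0 ?mulr_ge0 ?(ltW t0)// gerBl.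
      by rewrite mulr_ge0 ?exprn_ge0 ?mulr_ge0 ?(ltW t0).
    have -> : `|d k| * t ^+ k = `|d k * t ^+ k|.
      by rewrite normrM [`|t ^+ k|]ger0_norm// exprn_ge0// ltW.
    set S := \sum_(k.+1 <= n < _) _ in T *; rewrite lerBlDr.
    have := ler_normB (d k * t ^+ k + S) S; rewrite addrK => /le_trans; apply.
    by rewrite lerD2l.
  have : `|d k| * t ^+ k - (M * 2 ^+ k.+2) * t ^+ k.+1 <= 0.
    apply: (cvgr_to_ge lim); near=> N.
    have kN : (k.+1 <= N)%N by near: N; exact: nbhs_infty_ge.
    by rewrite -(subnKC kN); exact: part.
  by rewrite subr_le0 [t ^+ k.+1]exprSr mulrA [leRHS]mulrAC ler_pM2r// exprn_gt0.
apply/eqP; rewrite -normr_eq0 eq_le normr_ge0 andbT; apply/ler_addgt0Pl => e e0.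
rewrite addr0; set C := M * 2 ^+ k.+2 in bound.
have C0 : 0 <= C by rewrite mulr_ge0// exprn_ge0.
pose t := Num.min 4^-1 (e / (C + 1)).
have t0 : 0 < t by rewrite lt_min invr_gt0 ltr0n /= divr_gt0// ltr_wpDl.
apply: le_trans (bound t t0 _) _; first by rewrite ge_min lexx.
have : t <= e / (C + 1) by rewrite ge_min lexx orbT.
rewrite ler_pdivlMr ?ltr_wpDl//; nra.
Unshelve. all: by end_near. Qed.

End BinomialSeries.

(** * Sequences annihilated by a fractional difference *)

Lemma cvgMl_0 (K : numFieldType) (k : K) (f : nat -> K) :
  (f N @[N --> \oo]) --> (0 : K) -> (k * f N @[N --> \oo]) --> (0 : K).
Proof.
move=> f0; suff : (k * f N @[N --> \oo]) --> (k * 0 : K) by rewrite mulr0.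
exact: cvgMl_tmp.
Qed.

Lemma cvg_sum_0 (K : numFieldType) (V : normedModType K) n (f : nat -> nat -> V) :
  (forall j, (j < n)%N -> (f j N @[N --> \oo]) --> (0 : V)) ->
  (\sum_(j < n) f j N @[N --> \oo]) --> (0 : V).
Proof.
elim: n => [|n IH] h.
  by apply: (@cvg_ext _ (fun=> 0)) (cvg_cst _) => N; rewrite big_ord0.
suff : (\sum_(j < n.+1) f j N @[N --> \oo]) --> (0 + 0 : V) by rewrite addr0.
have IH0 : (\sum_(j < n) f j N @[N --> \oo]) --> (0 : V).
  by apply: IH => j jn; apply: h; apply: ltnW.
apply: (cvg_ext _ (cvgD IH0 (h n (ltnSn n)))) => N.
by rewrite big_ord_recr.
Qed.

Section Annihilation.
Variable R : realType.
Implicit Types a c : R.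

Lemma cvg_sum_gbin_bin a j : j%:R < a ->
  (\sum_(0 <= k < N) gbin a k * 'C(k, j)%:R @[N --> \oo]) --> (0 : R).
Proof.
move=> ja; rewrite -(cvg_shiftn j.+1).
have h : gbin a j * gbin (a - j%:R - 1) N @[N --> \oo] --> (0 : R).
  by apply: cvgMl_0; apply: cvg_gbin_0; rewrite subr_gt0.
by apply: cvg_ext h => N /=; rewrite -sum_gbin_bin addnS -addSn addnC.
Qed.

Lemma gbin_neq0 a n : (forall i, a != i%:R) -> gbin a n != 0.
Proof.
move=> aN; apply/prodf_neq0 => i _.
by rewrite mulf_neq0 ?invr_eq0 ?pnatr_eq0// subr_eq0 eq_sym.
Qed.

Lemma gbin_ratio_ge0 a p i : a <= p%:R ->
  exists2 r, 0 <= r & gbin a (p + i) = gbin a p * r.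
Proof.
move=> ap; elim: i => [|i [r r0 IH]]; first by exists 1; rewrite ?addn0 ?mulr1.
exists (r * (((p + i)%:R - a) / (p + i).+1%:R)); last by rewrite addnS gbinS IH -mulrA.
rewrite mulr_ge0// divr_ge0// subr_ge0 (le_trans ap)//.
by rewrite ler_nat leq_addr.
Qed.

Lemma normr_gbin_mul a c p q i j : a <= p%:R -> c <= q%:R ->
  `|gbin c (q + j) * gbin a (p + i)| =
  Num.sg (gbin c q * gbin a p) * (gbin c (q + j) * gbin a (p + i)).
Proof.
move=> ap cq; have [r r0 ->] := gbin_ratio_ge0 i ap.
have [s s0 ->] := gbin_ratio_ge0 j cq.
rewrite mulrACA normrM [`|s * r|]ger0_norm ?mulr_ge0//.
by rewrite [`|_|]normrEsg !mulrA.
Qed.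

(** The ratio (l - a) / (l + 1) of consecutive coefficients increases with l, so from p on it is at
    least its value at p. *)
Lemma gbin_backward a p l j : (0 <= a) -> a < p%:R -> (p <= l)%N ->
  `|gbin a l| <= (p.+1%:R / (p%:R - a)) ^+ j * `|gbin a (l + j)|.
Proof.
move=> a0 ap; elim: j l => [|j IH] l pl; first by rewrite expr0 mul1r addn0.
set K := p.+1%:R / _ in IH *.
have K0 : 0 <= K by rewrite divr_ge0// subr_ge0 ltW.
apply: (@le_trans _ _ (K * `|gbin a l.+1|)); last first.
  by rewrite exprS -mulrA ler_wpM2l// -addSnnS IH// (leq_trans pl).
rewrite gbinS normrM mulrCA ler_peMr// normrM normfV.
rewrite [`|l.+1%:R|]ger0_norm// mulrA ler_pdivlMr ?ltr0n// mul1r.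
have lp : p%:R <= l%:R :> R by rewrite ler_nat.
rewrite ger0_norm ?subr_ge0 ?(le_trans (ltW ap))//.
rewrite /K mulrAC ler_pdivlMr ?subr_gt0// -(natr1 l) -(natr1 p); nra.
Qed.

(** From q on the factors satisfy 0 <= n - c <= n - a, so the quotient of the absolute values does
    not grow. *)
Lemma gbin_dominated a c q l : a <= c -> c <= q%:R -> gbin a q != 0 ->
  (q <= l)%N -> `|gbin c l| <= `|gbin c q| / `|gbin a q| * `|gbin a l|.
Proof.
move=> ac cq aq0 /subnKC <-; elim: (l - q)%N => [|j IH].
  by rewrite addn0 divfK// normr_eq0.
rewrite addnS !gbinS !normrM [leRHS]mulrA; apply: ler_pM => //.
apply: ler_wpM2r => //.
have : q%:R <= (q + j)%:R :> R by rewrite ler_nat leq_addr.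
move=> h; rewrite !ger0_norm ?subr_ge0; lra.
Qed.

(* Beyond the indices p and q all terms have the same sign, and the whole sum  *)
(* vanishes for l > d, so the terms near both ends control the absolute sum.   *)
Lemma gbin_conv_bound a c p q d : 0 <= a -> a < p%:R -> a <= c -> c <= q%:R ->
  (p <= q)%N -> c + a = d%:R -> (forall n, gbin a n != 0) ->
  exists2 C, 0 <= C & exists L, forall l, (L <= l)%N ->
    \sum_(0 <= j < l.+1) `|gbin c j * gbin a (l - j)| <= C * `|gbin a l|.
Proof.
move=> a0 ap ac cq pq cad an0.
pose K := p.+1%:R / (p%:R - a).
have K0 : 0 <= K by rewrite divr_ge0// subr_ge0 ltW.
pose C' := `|gbin c q| / `|gbin a q|.
have C'0 : 0 <= C' by rewrite divr_ge0.
(* [C1] accounts for the first q terms and [C2] for the last p. The middle is at most their total,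
   whence the doubled constant. *)
pose C1 := \sum_(0 <= j < q) `|gbin c j| * K ^+ j.
pose C2 := \sum_(0 <= i < p) C' * K ^+ (p - i.+1) * `|gbin a (p - i.+1)|.
have C10 : 0 <= C1 by apply: sumr_ge0 => j _; rewrite mulr_ge0 ?exprn_ge0.
have C20 : 0 <= C2 by apply: sumr_ge0 => j _; rewrite !mulr_ge0// exprn_ge0.
exists ((C1 + C2) + (C1 + C2)); first by rewrite !addr_ge0.
exists (p + q + d)%N.+1 => l Ll; pose f j := gbin c j * gbin a (l - j).
rewrite -/(f _).
pose head := \sum_(0 <= j < q) `|f j|.
pose mid := \sum_(q <= j < l.+1 - p) `|f j|.
pose tail := \sum_(l.+1 - p <= j < l.+1) `|f j|.
have ql : (q <= l.+1 - p)%N by clear -Ll; lia.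
have split (g : nat -> R) : \sum_(0 <= j < l.+1) g j =
    \sum_(0 <= j < q) g j + \sum_(q <= j < l.+1 - p) g j +
    \sum_(l.+1 - p <= j < l.+1) g j.
  by rewrite (big_cat_nat (leq0n (l.+1 - p))) ?leq_subr//= (big_cat_nat (leq0n q)).
have headP : head <= C1 * `|gbin a l|.
  rewrite mulr_suml; apply: ler_sum_nat => j /andP[_ jq].
  rewrite /f normrM -mulrA ler_wpM2l//.
  have := @gbin_backward a p (l - j) j a0 ap; rewrite subnK; last by clear -Ll jq; lia.
  by apply; clear -Ll jq pq; lia.
have tailP : tail <= C2 * `|gbin a l|.
  rewrite /tail -{1}[(l.+1 - p)%N]add0n big_addn subKn; last by clear -Ll; lia.
  rewrite mulr_suml; apply: ler_sum_nat => i /andP[_ ip].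
  rewrite /f normrM (_ : l - _ = p - i.+1)%N; last by clear -Ll ip; lia.
  rewrite mulrAC ler_wpM2r//.
  apply: le_trans (gbin_dominated ac cq (an0 q) _) _; first by clear -Ll ip; lia.
  rewrite -/C' -[leRHS]mulrA ler_wpM2l//.
  have := @gbin_backward a p (i + (l.+1 - p)) (p - i.+1) a0 ap.
  rewrite (_ : _ + (p - i.+1) = l)%N; last by clear -Ll ip; lia.
  by apply; clear -Ll ip pq; lia.
have midP : mid <= head + tail.
  have midE : mid = Num.sg (gbin c q * gbin a p) * \sum_(q <= j < l.+1 - p) f j.
    rewrite mulr_sumr; apply: eq_big_nat => j /andP[qj jl].
    have := @normr_gbin_mul a c p q (l - j - p) (j - q) (ltW ap) cq.
    have -> : (q + (j - q) = j)%N by rewrite subnKC.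
    by have -> : (p + (l - j - p) = l - j)%N by rewrite subnKC//; clear -jl; lia.
  have tot : \sum_(0 <= j < l.+1) f j = 0.
    by rewrite gbin_conv cad gbin_nat_eq0//; clear -Ll; lia.
  have {}tot : \sum_(q <= j < l.+1 - p) f j =
     - (\sum_(0 <= j < q) f j + \sum_(l.+1 - p <= j < l.+1) f j).
    by apply/eqP; rewrite -addr_eq0 addrCA addrA -(split f) tot.
  have mid0 : 0 <= mid by apply: sumr_ge0.
  rewrite -(ger0_norm mid0) midE tot normrM normrN normr_sg.
  apply: (@le_trans _ _ `|\sum_(0 <= j < q) f j + \sum_(l.+1 - p <= j < l.+1) f j|).
    by rewrite ler_piMl//; case: (_ != 0).
  apply: le_trans (ler_normD _ _) _.
  by rewrite lerD// /head /tail ler_norm_sum.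
rewrite split -/head -/mid -/tail mulrDl; lra.
Qed.


(** Collect by l = j + k. For l < N the coefficient of x_l is a complete convolution, equal to
    [gbin d%:R l]; for N <= l < K the convolution is cut at j < N. *)
Lemma sum_gbin_truncated (a c : R) (x : nat -> R) d N K : (d < N)%N -> (N <= K)%N ->
  c + a = d%:R ->
  \sum_(j < N) gbin c j * \sum_(0 <= k < K - j) gbin a k * x (j + k)%N =
  (-1) ^+ d * iter d (@fdiff R) x 0%N +
  \sum_(N <= l < K) (\sum_(0 <= j < N) gbin c j * gbin a (l - j)) * x l.
Proof.
move=> dN NK cad.
pose g j l := if (j <= l)%N then gbin c j * gbin a (l - j) else 0.
transitivity (\sum_(0 <= j < N) \sum_(0 <= l < K) g j l * x l).
  rewrite big_mkord; apply: eq_bigr => j _.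
  have jK : (j <= K)%N by apply: leq_trans NK; exact: ltnW.
  rewrite [RHS](big_cat_nat (leq0n j) jK)/= [X in _ = X + _]big_nat.
  rewrite [X in _ = X + _]big1 ?add0r => [|l /andP[_ lj]]; last first.
    by rewrite /g leqNgt lj mul0r.
  have := big_addn 0 K j xpredT (fun l => g j l * x l); rewrite add0n => ->.
  rewrite mulr_sumr; apply: eq_bigr => k _.
  by rewrite /g leq_addl addnK addnC mulrA.
rewrite exchange_big_nat (big_cat_nat (leq0n N) NK)/=; congr (_ + _).
  rewrite -(sum_gbin_nat x dN); apply: eq_big_nat => l /andP[_ lN].
  rewrite -mulr_suml; congr (_ * _); rewrite -cad -gbin_conv.
  rewrite (big_cat_nat (leq0n l.+1) lN)/= [X in _ + X]big_nat [X in _ + X]big1 ?addr0.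
    by apply: eq_big_nat => j /andP[_ jl]; rewrite /g -ltnS jl.
  by move=> j /andP[lj _]; rewrite /g leqNgt lj.
apply: eq_big_nat => l /andP[Nl _]; rewrite -mulr_suml; congr (_ * _).
by apply: eq_big_nat => j /andP[_ jN]; rewrite /g (leq_trans (ltnW jN)).
Qed.

(* Applying a truncation of (1 - S)^c to (1 - S)^a x = 0, where S is the shift *)
(* and c + a = d, gives (1 - S)^d x up to a tail of the series (1 - S)^a x.    *)
Lemma gbin_annihilated_nat a c p q d (x : nat -> R) :
  0 <= a -> a < p%:R -> a <= c -> c <= q%:R -> (p <= q)%N -> c + a = d%:R ->
  (forall n, gbin a n != 0) -> (forall n, 0 <= x n) ->
  (forall n, \sum_(0 <= k < N) gbin a k * x (n + k)%N @[N --> \oo] --> (0 : R)) ->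
  iter d (@fdiff R) x 0%N = 0.
Proof.
move=> a0 ap ac cq pq cad an0 x0 xcvg.
have [C C0 [L hL]] := gbin_conv_bound a0 ap ac cq pq cad an0.
apply/eqP; rewrite -normr_eq0 eq_le normr_ge0 andbT; apply/ler_addgt0Pl => e e0.
(* Chosen so that e' for [Z K] plus C (e' + e') for the tail equals e. *)
rewrite addr0; pose e' := e / (1 + 2 * C).
have C1 : 0 < 1 + 2 * C by rewrite ltr_wpDr// mulr_ge0.
have e'0 : 0 < e' by rewrite divr_gt0.
pose S N := \sum_(0 <= k < N) gbin a k * x k.
have [N0 hN0] : exists N0, forall N, (N0 <= N)%N -> `|S N| <= e'.
  have /cvgr0Pnorm_le/(_ e' e'0) [N0 _ h] := xcvg 0%N.
  by exists N0.
pose N := (N0 + L + d.+1 + p)%N.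
have Np : (p <= N)%N by rewrite leq_addl.
have NL : (L <= N)%N by rewrite /N; clear; lia.
have NN0 : (N0 <= N)%N by rewrite /N; clear; lia.
have dN : (d < N)%N by rewrite /N; clear; lia.
pose Z K := \sum_(j < N) gbin c j * \sum_(0 <= k < K - j) gbin a k * x (j + k)%N.
have Z0 : Z K @[K --> \oo] --> (0 : R).
  apply: (@cvg_sum_0 R R N (fun j K =>
    gbin c j * \sum_(0 <= k < K - j) gbin a k * x (j + k)%N)).
  move=> j _; apply: cvgMl_0.
  exact: (@cvg_comp _ _ _ (subn^~ j)
    (fun M => \sum_(0 <= k < M) gbin a k * x (j + k)%N) _ _ _ (cvg_subnr j) (xcvg j)).
have [K1 hK1] : exists K1, forall K, (K1 <= K)%N -> `|Z K| <= e'.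
  have /cvgr0Pnorm_le/(_ e' e'0) [K1 _ h] := Z0.
  by exists K1.
pose K := (K1 + N)%N.
have NK : (N <= K)%N by rewrite leq_addl.
(* From p on the coefficients have one sign, so up to sign this is a difference of two partial sums
   of the convergent series. *)
have tail : \sum_(N <= l < K) `|gbin a l| * x l <= e' + e'.
  have -> : \sum_(N <= l < K) `|gbin a l| * x l = Num.sg (gbin a p) * (S K - S N).
    rewrite /S (big_cat_nat (leq0n N) NK)/= addrAC subrr add0r mulr_sumr.
    apply: eq_big_nat => l /andP[Nl _].
    have [r r0 ->] : exists2 r, 0 <= r & gbin a l = gbin a p * r.
      by rewrite -(subnKC (leq_trans Np Nl)); exact/gbin_ratio_ge0/ltW.
    by rewrite normrM (ger0_norm r0) [`|_|]normrEsg !mulrA.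
  apply: le_trans (ler_norm _) _; rewrite normrM.
  apply: (@le_trans _ _ `|S K - S N|).
    by rewrite ler_piMl// normr_sg; case: (_ != 0).
  apply: le_trans (ler_normB _ _) _.
  by rewrite lerD// hN0// (leq_trans NN0).
have -> : `|iter d (@fdiff R) x 0%N| = `|(-1) ^+ d * iter d (@fdiff R) x 0%N|.
  by rewrite normrM normrX normrN1 expr1n mul1r.
have := sum_gbin_truncated x dN NK cad; rewrite -/(Z K) => /esym/(canRL (addrK _)) ->.
apply: le_trans (ler_normB _ _) _.
have -> : e = e' + C * (e' + e') by rewrite /e'; field; rewrite gt_eqF.
apply: lerD; first by rewrite hK1// leq_addr.
apply: le_trans (ler_norm_sum _ _ _) _.
apply: (@le_trans _ _ (\sum_(N <= l < K) C * (`|gbin a l| * x l))); last first.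
  by rewrite -mulr_sumr ler_wpM2l.
apply: ler_sum_nat => l /andP[Nl _].
rewrite normrM (ger0_norm (x0 l)) mulrA ler_wpM2r//.
apply: le_trans (ler_norm_sum _ _ _) _.
apply: le_trans (hL l (leq_trans NL Nl)).
by rewrite [leRHS](big_cat_nat (leq0n N)) 1?ltnW ?ltnS//= lerDl sumr_ge0.
Qed.

Lemma gbin_annihilated_fdiff a (x : nat -> R) :
  (forall n, \sum_(0 <= k < N) gbin a k * x (n + k)%N @[N --> \oo] --> (0 : R)) ->
  forall n, \sum_(0 <= k < N) gbin a k * fdiff x (n + k)%N @[N --> \oo] --> (0 : R).
Proof.
move=> xcvg n; suff : \sum_(0 <= k < N) gbin a k * fdiff x (n + k)%N @[N --> \oo] -->
  (0 - 0 : R) by rewrite subrr.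
apply: (cvg_ext _ (cvgB (xcvg n.+1) (xcvg n))) => N.
transitivity (\sum_(0 <= k < N) gbin a k * x (n.+1 + k)%N -
  \sum_(0 <= k < N) gbin a k * x (n + k)%N) => //.
by rewrite -sumrB; apply: eq_bigr => k _; rewrite -mulrBr.
Qed.

(* The binomial sums of gbin a against 'C(k, j) tend to 0 for j < a, but stay  *)
(* away from 0 for j = m + 1 > a.                                              *)
Lemma gbin_annihilated_lower a m (x : nat -> R) :
  m%:R < a < m.+1%:R ->
  (forall n, \sum_(0 <= k < N) gbin a k * x (n + k)%N @[N --> \oo] --> (0 : R)) ->
  (forall n, iter m.+2 (@fdiff R) x n = 0) ->
  forall n, iter m.+1 (@fdiff R) x n = 0.
Proof.
move=> /andP[ma am] xcvg x0 n.
have aN i : a != i%:R.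
  apply/eqP => ai; move: ma am; rewrite ai !ltr_nat; lia.
pose y k := x (n + k)%N; pose A j N := \sum_(0 <= k < N) gbin a k * 'C(k, j)%:R.
have y0 i : iter m.+2 (@fdiff R) y i = 0 by rewrite iter_fdiff_shift x0.
pose D j := iter j (@fdiff R) y 0%N.
have -> : iter m.+1 (@fdiff R) x n = D m.+1 by rewrite /D iter_fdiff_shift addn0.
have low : \sum_(j < m.+1) D j * A j N @[N --> \oo] --> (0 : R).
  apply: (@cvg_sum_0 R R m.+1 (fun j N => D j * A j N)) => j jm.
  apply: cvgMl_0; apply: cvg_sum_gbin_bin.
  by apply: le_lt_trans ma; rewrite ler_nat.
have top : D m.+1 * A m.+1 N @[N --> \oo] --> (0 : R).
  suff : D m.+1 * A m.+1 N @[N --> \oo] --> (0 - 0 : R) by rewrite subrr.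
  apply: (cvg_ext _ (cvgB (xcvg n) low)) => N.
  transitivity (\sum_(0 <= k < N) gbin a k * y k - \sum_(j < m.+1) D j * A j N) => //.
  by rewrite (sum_gbin_newton a _ y0) big_ord_recr /= addrAC subrr add0r.
have key : `|D m.+1| * `|gbin a m.+1| <= 0.
  have /cvg_norm := top; rewrite normr0 => /cvgr_to_ge; apply.
  near=> N.
  have mN : (m.+2 <= N)%N by near: N; exact: nbhs_infty_ge.
  rewrite normrM ler_wpM2l// -(subnKC mN) /A addSnnS sum_gbin_bin normrM.
  by rewrite ler_peMr// norm_gbin_ge1// subr_le0 ltW.
apply/eqP; rewrite -normr_eq0 eq_le normr_ge0 andbT.
by rewrite -(@pmulr_lle0 _ `|gbin a m.+1|)// normr_gt0 gbin_neq0.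
Unshelve. all: by end_near. Qed.

Lemma gbin_annihilated a m (x : nat -> R) :
  m%:R < a < m.+1%:R -> (forall n, 0 <= x n) ->
  (forall n, \sum_(0 <= k < N) gbin a k * x (n + k)%N @[N --> \oo] --> (0 : R)) ->
  forall n, iter m.+1 (@fdiff R) x n = 0.
Proof.
move=> mam; have /andP[ma am] := mam => x0 xcvg.
have aN i : a != i%:R.
  apply/eqP => ai; move: ma am; rewrite ai !ltr_nat; lia.
have m0 : 0 <= m%:R :> R by [].
have top n : iter (m.+1 + m.+1) (@fdiff R) x n = 0.
  have := iter_fdiff_shift x (m.+1 + m.+1) n 0; rewrite addn0 => <-.
  (* With c = 2m + 2 - a, the bounds m < a < m + 1 give a < m + 1 < c < m + 2. *)
  apply: (@gbin_annihilated_nat a ((m.+1 + m.+1)%:R - a) m.+1 m.+2).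
  - lra.
  - by [].
  - rewrite natrD; lra.
  - move: ma; rewrite natrD -!(natr1 m.+1) -!(natr1 m); lra.
  - by [].
  - by rewrite subrK.
  - by move=> i; exact: gbin_neq0.
  - by [].
  - move=> i; apply: cvg_ext (xcvg (n + i)%N) => N.
    by under eq_bigr do rewrite -addnA.
have Pk k : forall n, \sum_(0 <= l < N) gbin a l * iter k (@fdiff R) x (n + l)%N
    @[N --> \oo] --> (0 : R).
  by elim: k => [|k IH] //; exact: gbin_annihilated_fdiff.
(* Each step applies [gbin_annihilated_lower] to the k-th difference of x, which satisfies the same
   relation by [Pk]. *)
have down k : (forall n, iter (m.+1 + k) (@fdiff R) x n = 0) ->
    forall n, iter m.+1 (@fdiff R) x n = 0.
  elim: k => [|k IH] h; first by move=> n; rewrite -[m.+1]addn0.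
  apply: IH => n; rewrite iterD; apply: (gbin_annihilated_lower mam (Pk k)) => i.
  by rewrite -iterD addSnnS.
exact: down top.
Qed.

End Annihilation.

(** * Operators on a Hilbert space *)

Section Hilbert.
Variables (R : realType) (H : completeNormedModType R[i]).
Variable ip : {dot H for (@Num.conj R[i])}.
Hypothesis hip : induces_norm ip.

(** H as a real inner product space: norms take values in R[i], while the estimates are made in
    R. *)
Definition rip (x y : H) : R := complex.Re (ip x y).
Definition nsq (x : H) : R := rip x x.

Lemma ReD (x y : R[i]) : complex.Re (x + y) = complex.Re x + complex.Re y.
Proof. by case: x; case: y. Qed.
Lemma ReN (x : R[i]) : complex.Re (- x) = - complex.Re x. Proof. by case: x. Qed.

Lemma ipE x : ip x x = (nsq x)%:C.
Proof. by rewrite RRe_real// ger0_real// dnorm_ge0. Qed.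

Lemma norm_sqE x : `|x| ^+ 2 = (nsq x)%:C.
Proof. by rewrite -hip ipE. Qed.

Lemma ripDl x y z : rip (x + y) z = rip x z + rip y z.
Proof. by rewrite /rip linearDl ReD. Qed.
Lemma ripNl x z : rip (- x) z = - rip x z.
Proof. by rewrite /rip linearNl ReN. Qed.
Lemma rip0l y : rip 0 y = 0. Proof. by rewrite /rip linear0l. Qed.
Lemma ripC x y : rip x y = rip y x.
Proof.
rewrite /rip hermC expr0 mul1r; apply: complexI.
by rewrite !complexRe Re_conj.
Qed.
Lemma ripDr x y z : rip x (y + z) = rip x y + rip x z.
Proof. by rewrite ![rip x _]ripC ripDl. Qed.
Lemma ripNr x y : rip x (- y) = - rip x y.
Proof. by rewrite ![rip x _]ripC ripNl. Qed.
Lemma ripZl (a : R) x y : rip (a%:C *: x) y = a * rip x y.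
Proof. by rewrite /rip linearZl_LR /=; case: (ip x y) => p q /=; rewrite mul0r subr0. Qed.
Lemma ripZr (a : R) x y : rip x (a%:C *: y) = a * rip x y.
Proof. by rewrite ripC ripZl ripC. Qed.
Lemma nsq_ge0 x : 0 <= nsq x.
Proof. by rewrite -ler0c -ipE; exact: dnorm_ge0. Qed.
Lemma nsq_eq0 x : nsq x = 0 -> x = 0.
Proof. by move=> x0; apply/eqP; rewrite -(dnorm_eq0 ip) ipE x0. Qed.

Lemma norm_ltE x (e : R) : 0 < e -> (`|x| < e%:C) = (nsq x < e ^+ 2).
Proof.
move=> e0; have e0C : 0 <= e%:C :> R[i] by rewrite ler0c ltW.
by rewrite -ltcR -norm_sqE rmorphXn ltr_pXn2r// nnegrE.
Qed.

(** Cauchy-Schwarz, from the squared length of <x,x> y - <x,y> x. *)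
Lemma sqr_ripP x y : rip x y ^+ 2 <= nsq x * nsq y.
Proof.
have [x0|x0] := eqVneq (nsq x) 0.
  by rewrite (nsq_eq0 x0) /nsq !rip0l expr2 !mul0r.
have xp : 0 < nsq x by rewrite lt_def x0 nsq_ge0.
have := nsq_ge0 ((nsq x)%:C *: y - (rip x y)%:C *: x).
rewrite /nsq !(ripDl, ripDr, ripNl, ripNr, ripZl, ripZr) -/(nsq x) -/(nsq y).
rewrite [rip y x]ripC.
rewrite (_ : _ + _ = nsq x * (nsq x * nsq y - rip x y ^+ 2)); last by ring.
by rewrite pmulr_rge0// subr_ge0.
Qed.

Lemma cvg_nsqP (z : nat -> H) l :
  (z n @[n --> \oo] --> l) <->
  (forall e : R, 0 < e -> \forall n \near \oo, nsq (l - z n) < e).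
Proof.
split=> [/cvgrPdist_lt h e e0|h].
  have se : 0 < (Num.sqrt e)%:C :> R[i] by rewrite ltcR sqrtr_gt0.
  near=> n.
  have : `|l - z n| < (Num.sqrt e)%:C by near: n; exact: h.
  by rewrite norm_ltE ?sqrtr_gt0// sqr_sqrtr// ltW.
apply/cvgrPdist_lt => e e0.
have eE : e = (complex.Re e)%:C by rewrite RRe_real// gtr0_real.
rewrite eE ltcR in e0; rewrite eE; near=> n.
by rewrite norm_ltE//; near: n; apply: h; rewrite exprn_gt0.
Unshelve. all: by end_near. Qed.

(* A near minimizer of |x|^2 - 2 f x satisfies f = rip z up to a small error,  *)
(* so that a minimizing sequence is Cauchy and its limit represents f.         *)
Lemma riesz_real (f : H -> R) (B : R) : 0 <= B ->
  {morph f : x y / x + y} -> (forall a x, f (a%:C *: x) = a * f x) ->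
  (forall x, f x ^+ 2 <= B * nsq x) ->
  exists z, forall x, f x = rip x z.
Proof.
move=> B0 fD fZ fB; pose J x := nsq x - 2 * f x.
have Jlb x : - B <= J x.
  have := fB x; have := nsq_ge0 x; rewrite /J; set q := nsq x; set w := f x => q0 wB.
  have [w0|w0] := leP w 0; first lra.
  have : 2 * w <= q + B.
    rewrite -(@ler_pXn2r _ 2)// ?nnegrE ?mulr_ge0 ?addr_ge0 ?(ltW w0)//.
    have := sqr_ge0 (q - B); nra.
  lra.
have hinf : has_inf (range J).
  by split; [exists (J 0), 0|exists (- B) => _ [x _ <-]].
have near_min n : exists z, J z < inf (range J) + n.+1%:R^-1.
  have [|_ [z _ <-] hz] := @inf_adherent R (range J) n.+1%:R^-1 _ hinf.
    by rewrite invr_gt0.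
  by exists z.
have [z hz] := choice near_min.
have perturb n x : (rip (z n) x - f x) ^+ 2 <= n.+1%:R^-1 * nsq x.
  set A := _ - _; set e := n.+1%:R^-1.
  (* Moving from [z n] along x cannot lower J by more than e; the minimizing s = - A / nsq x gives
     the bound on A^2. *)
  have quad s : 0 <= e + 2 * s * A + s ^+ 2 * nsq x.
    have : inf (range J) <= J (z n + s%:C *: x).
      by apply: inf_lbound; [exact: hinf.2|exists (z n + s%:C *: x)].
    have := hz n; rewrite -/e /J fD fZ /nsq !(ripDl, ripDr, ripZl, ripZr).
    rewrite [rip x (z n)]ripC /A; lra.
  have [q0|q0] := eqVneq (nsq x) 0.
    have f0 : f 0 = 0 by have := fD 0 0; rewrite addr0; lra.
    rewrite /A (nsq_eq0 q0) ripC rip0l f0 subrr expr0n.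
    by rewrite mulr_ge0 ?nsq_ge0// invr_ge0.
  have qp : 0 < nsq x by rewrite lt_def q0 nsq_ge0.
  have := quad (- A / nsq x).
  have -> : e + 2 * (- A / nsq x) * A + (- A / nsq x) ^+ 2 * nsq x =
    e - A ^+ 2 / nsq x by field.
  by rewrite subr_ge0 ler_pdivrMr.
(* Apply [perturb] for n and for m in the direction z n - z m; the values of f cancel in the
   difference. *)
have close n m : nsq (z n - z m) <= 2 * (n.+1%:R^-1 + m.+1%:R^-1).
  have := perturb n (z n - z m); have := perturb m (z n - z m).
  set q := nsq _; set d := f _ => hm hn.
  have q0 : 0 <= q by exact: nsq_ge0.
  have qE : q = (rip (z n) (z n - z m) - d) - (rip (z m) (z n - z m) - d).
    by rewrite /q /nsq ripDl ripNl; ring.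
  move: hm hn qE; set u := rip _ _ - d; set v := rip _ _ - d => hm hn qE.
  have [->|q1] := eqVneq q 0; first by rewrite mulr_ge0// addr_ge0// invr_ge0.
  have qp : 0 < q by rewrite lt_def q1.
  rewrite -(ler_pM2r qp); have := sqr_ge0 (u + v).
  have -> : q * q = (v - u) ^+ 2 by rewrite -expr2 {1}qE.
  rewrite {qE} in hm hn *; move: (n.+1%:R^-1) (m.+1%:R^-1) hm hn => en em hm hn.
  nra.
have zc : cvgn z.
  apply/cauchy_cvgP; apply: cauchy_exP => e e0.
  have eE : e = (complex.Re e)%:C by rewrite RRe_real// gtr0_real.
  rewrite eE ltcR in e0; rewrite eE; set r := complex.Re e in e0 *.
  have r0 : 0 < r ^+ 2 / 4 by rewrite divr_gt0 ?exprn_gt0.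
  near \oo => N; exists (z N).
  suff : \forall n \near \oo, ball (z N) r%:C (z n) by [].
  near=> n.
  rewrite -ball_normE /= norm_ltE//; apply: le_lt_trans (close N n) _.
  have hN : N.+1%:R^-1 < r ^+ 2 / 4.
    by near: N; exact: (near_infty_natSinv_lt (PosNum r0)).
  have hn : n.+1%:R^-1 < r ^+ 2 / 4.
    by near: n; exact: (near_infty_natSinv_lt (PosNum r0)).
  move: (N.+1%:R^-1) (n.+1%:R^-1) hN hn => eN en hN hn; lra.
exists (limn z) => x; apply/eqP; rewrite eq_sym -subr_eq0 -sqrf_eq0 eq_le sqr_ge0 andbT.
apply/ler_addgt0Pl => e e0; rewrite addr0.
pose r := e / (4 * (nsq x + 1)).
have q0 := nsq_ge0 x.
have r0 : 0 < r by rewrite divr_gt0// mulr_gt0// ltr_wpDl.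
near \oo => n.
have h1 : nsq (limn z - z n) < r by near: n; apply: (cvg_nsqP _ _).1.
have h2 : n.+1%:R^-1 < r by near: n; exact: (near_infty_natSinv_lt (PosNum r0)).
have h3 := perturb n x; have h4 := sqr_ripP (limn z - z n) x.
rewrite [rip x _]ripC.
have -> : rip (limn z) x - f x = rip (limn z - z n) x + (rip (z n) x - f x).
  by rewrite ripDl ripNl; ring.
have eE : e = 4 * r * (nsq x + 1) by rewrite /r; field; rewrite gt_eqF// ltr_wpDl.
have {}h3 : (rip (z n) x - f x) ^+ 2 <= r * nsq x.
  by apply: le_trans h3 _; rewrite ler_wpM2r// ltW.
have {}h4 : (rip (limn z - z n) x) ^+ 2 <= r * nsq x.
  by apply: le_trans h4 _; rewrite ler_wpM2r// ltW.
have := sqr_ge0 (rip (limn z - z n) x - (rip (z n) x - f x)).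
move: h3 h4; rewrite eE; set u := rip (limn z - z n) x; set v := rip (z n) x - f x; nra.
Unshelve. all: by end_near. Qed.

(** * The adjoint, and isometries in terms of differences of squared norms *)

Variable T : {linear H -> H}.
Hypothesis hT : bounded_near T (nbhs (0 : H)).

Lemma nsq_bounded : exists2 B : R, 0 < B & forall x, nsq (T x) <= B * nsq x.
Proof.
have [M M0 hM] := pinfty_ex_gt0 ((linear_boundedP T).1 hT).
have ME : M = (complex.Re M)%:C by rewrite RRe_real// gtr0_real.
move: M0 hM; rewrite ME ltcR => M0 hM.
exists (complex.Re M ^+ 2); first by rewrite exprn_gt0.
move=> x; rewrite -lecR -norm_sqE rmorphM rmorphXn /= -norm_sqE -exprMn.
by rewrite lerXn2r ?nnegrE// mulr_ge0// ler0c ltW.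
Qed.

(** [riesz_real] represents x |-> Re <Tx, y>, so the set defining [adjoint] is inhabited once
    imaginary parts agree as well. *)
Lemma ip_adjoint x y : ip (T x) y = ip x (adjoint ip T y).
Proof.
have [B B0 hB] := nsq_bounded.
suff [z hz] : exists z, forall x, ip (T x) y = ip x z.
  by rewrite /adjoint; case: xgetP => [w -> //|/(_ z)]; case.
have [|x1 x2|a x1|x1|z hz] := @riesz_real (fun x => rip (T x) y) (B * nsq y).
- by rewrite mulr_ge0 ?nsq_ge0// ltW.
- by rewrite linearD ripDl.
- by rewrite linearZ ripZl.
- apply: le_trans (sqr_ripP _ _) _; rewrite mulrAC ler_wpM2r ?nsq_ge0//.
exists z => x1.
(* Replacing x by ix exchanges real and imaginary parts up to sign. *)
have hI := hz ('i%C *: x1); rewrite linearZ /rip /= !linearZl_LR /= in hI.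
have := hz x1; rewrite /rip => hR.
move: hI hR; case: (ip (T x1) y) (ip x1 z) => [p q] [p' q'] /= h1 h2.
congr Complex; lra.
Qed.

Let U := adjoint ip T.

Lemma ip_iter_adjoint n x y : ip (iter n T x) y = ip x (iter n U y).
Proof.
elim: n x y => [//|n IH] x y; rewrite iterS ip_adjoint IH.
by rewrite -iterSr.
Qed.

Let u h n := iter n U (iter n T h).

Lemma rip_iter_adjoint n k h : rip k (u h n) = rip (iter n T k) (iter n T h).
Proof. by rewrite /rip /u ip_iter_adjoint. Qed.

(** Pair the operator series at g = T^n h with g itself: the k-th term becomes [gbin a k] times
    |T^(n+k) h|^2, and Cauchy-Schwarz carries over the limit. *)
Lemma isometry_sum_nsq a h n : isometry_of_order ip a T ->
  \sum_(0 <= k < N) gbin a k * nsq (iter (n + k) T h) @[N --> \oo] --> (0 : R).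
Proof.
case=> alpha ha Scvg.
have -> : gbin a = alpha.
  by apply: binomial_expansion_uniq ha; exact: binomial_expansion_gbin.
pose g := iter n T h.
pose S N := \sum_(0 <= k < N) (alpha k)%:C *: u g k.
have SE N : \sum_(0 <= k < N) alpha k * nsq (iter (n + k) T h) = rip g (S N).
  rewrite /S; elim: N => [|N IH]; first by rewrite !big_geq// ripC rip0l.
  rewrite !big_nat_recr //= ripDr ripZr IH; congr (_ + _ * _).
  by rewrite rip_iter_adjoint /g -iterD addnC.
apply: (cvg_ext (fun N => esym (SE N))).
have /cvg_nsqP h0 := Scvg g.
have q0 := nsq_ge0 g; have q1 : 0 < nsq g + 1 by rewrite ltr_wpDl.
apply/cvgrPdist_lt => e e0; near=> N.
rewrite sub0r normrN -(@ltr_pXn2r _ 2)// ?nnegrE ?(ltW e0)// real_normK ?num_real//.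
apply: le_lt_trans (sqr_ripP _ _) _.
have SN : nsq (S N) < e ^+ 2 / (nsq g + 1).
  have -> : nsq (S N) = nsq (0 - S N).
    by rewrite sub0r /nsq ripNl ripNr opprK.
  by near: N; apply: h0; rewrite divr_gt0 ?exprn_gt0.
move: SN; rewrite ltr_pdivlMr//; have := nsq_ge0 (S N); nra.
Unshelve. all: by end_near. Qed.

Lemma isometry_fdiff a m : m%:R < a <= m.+1%:R -> isometry_of_order ip a T ->
  forall h n, iter m.+1 (@fdiff R) (fun i => nsq (iter i T h)) n = 0.
Proof.
move=> /andP[ma]; rewrite le_eqVlt => /predU1P[-> Ta h n|am Ta h n]; last first.
  apply: (@gbin_annihilated R a m); first by rewrite ma.
    by move=> i; exact: nsq_ge0.
  by move=> i; exact: isometry_sum_nsq.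
have lim := isometry_sum_nsq h n Ta.
(* For a = m + 1 the partial sums are constant beyond N = m + 1, so that constant is the limit 0. *)
have c0 : (-1) ^+ m.+1 * iter m.+1 (@fdiff R) (fun i => nsq (iter i T h)) n = 0.
  apply/eqP; rewrite eq_le; apply/andP; split.
    apply: (cvgr_to_ge lim); near=> N.
    rewrite sum_gbin_nat; last by near: N; exact: nbhs_infty_gt.
    by rewrite (iter_fdiff_shift (fun i => nsq (iter i T h))) addn0.
  apply: (cvgr_to_le lim); near=> N.
  rewrite sum_gbin_nat; last by near: N; exact: nbhs_infty_gt.
  by rewrite (iter_fdiff_shift (fun i => nsq (iter i T h))) addn0.
by move/eqP: c0; rewrite mulf_eq0 signr_eq0 => /eqP.
Unshelve. all: by end_near. Qed.

(* By polarization the quadratic forms |T^n h|^2 determine T*^n T^n. *)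
Lemma fdiff_adjoint d :
  (forall h n, iter d (@fdiff R) (fun i => nsq (iter i T h)) n = 0) ->
  forall h n, iter d (@fdiff H) (u h) n = 0.
Proof.
move=> T0 h n; apply: nsq_eq0; set v := iter _ _ _ n; rewrite /nsq /v.
rewrite -(@morph_iter_fdiff _ _ (rip v)); last by move=> x y; rewrite ripDr ripNr.
pose Q g i := nsq (iter i T g).
have -> : (fun i => rip v (u h i)) = (fun i => (Q (v + h) i - (Q v i + Q h i)) / 2).
  apply/funext => i; rewrite rip_iter_adjoint /Q.
  have -> : iter i T (v + h) = iter i T v + iter i T h.
    by elim: i => [//|i IH]; rewrite !iterS IH linearD.
  by rewrite /nsq !(ripDl, ripDr) [rip (iter i T h) (iter i T v)]ripC; field.
have E (f1 f2 f3 : nat -> R) j i :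
    iter j (@fdiff R) (fun i => (f1 i - (f2 i + f3 i)) / 2) i =
    (iter j (@fdiff R) f1 i - (iter j (@fdiff R) f2 i + iter j (@fdiff R) f3 i)) / 2.
  by elim: j i => [//|j IH] i; rewrite !iterS /fdiff !IH; ring.
by rewrite E !T0 addr0 subrr mul0r.
Qed.

(** By [fdiff_adjoint] and Newton's formula the partial sums at h lie in the span of m + 1 fixed
    vectors; the coefficients tend to 0 by [cvg_sum_gbin_bin], since j <= m < a. *)
Lemma fdiff_isometry a m : m%:R < a ->
  (forall h n, iter m.+1 (@fdiff R) (fun i => nsq (iter i T h)) n = 0) ->
  isometry_of_order ip a T.
Proof.
move=> ma T0; exists (gbin a); first exact: binomial_expansion_gbin.
move=> h; pose b j := iter j (@fdiff H) (u h) 0%N.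
pose A j N := \sum_(0 <= k < N) gbin a k * 'C(k, j)%:R.
have SE N : \sum_(j < m.+1) (A j N)%:C *: b j = \sum_(0 <= k < N) (gbin a k)%:C *: u h k.
  under [RHS]eq_bigr => k _ do
    rewrite (newton_fdiff_trunc _ (fdiff_adjoint T0 h)) scaler_sumr.
  rewrite exchange_big /=; apply: eq_bigr => j _.
  rewrite /A rmorph_sum scaler_suml; apply: eq_bigr => k _.
  by rewrite rmorphM rmorph_nat -scalerA scaler_nat.
apply: (cvg_ext SE); apply: (@cvg_sum_0 _ _ m.+1 (fun j N => (A j N)%:C *: b j)) => j jm.
have A0 : A j N @[N --> \oo] --> (0 : R).
  by apply: cvg_sum_gbin_bin; apply: le_lt_trans ma; rewrite ler_nat.
apply/cvg_nsqP => e e0; have q0 := nsq_ge0 (b j).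
have q1 : 0 < nsq (b j) + 1 by rewrite ltr_wpDl.
have r0 : 0 < Num.sqrt (e / (nsq (b j) + 1)) by rewrite sqrtr_gt0 divr_gt0.
near=> N.
have : `|A j N| < Num.sqrt (e / (nsq (b j) + 1)).
  rewrite -[A j N]opprK normrN -[- A j N]sub0r.
  by near: N; move/cvgrPdist_lt: A0; exact.
rewrite -(@ltr_pXn2r _ 2)// ?nnegrE ?(ltW r0)// real_normK ?num_real//.
rewrite sqr_sqrtr ?divr_ge0 ?(ltW e0) ?(ltW q1)// ltr_pdivlMr//.
rewrite sub0r /nsq ripNl ripNr opprK ripZl ripZr -/(nsq (b j)).
have := sqr_ge0 (A j N); rewrite expr2; nra.
Unshelve. all: by end_near. Qed.

End Hilbert.

Theorem theorem1p6 (R : realType) (H : completeNormedModType R[i])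
    (ip : {dot H for (@Num.conj R[i])}) (hip : induces_norm ip)
    (hsep : separable_space H)
    (T : {linear H -> H}) (hT : bounded_near T (nbhs (0 : H)))
    (a : R) (m : nat) (ha : 0 < a) (ham : m%:R < a <= m.+1%:R) :
  [<-> isometry_of_order ip a T;
       isometry_of_order ip m.+1%:R T;
       forall h : H, exists p : {poly R},
         (size p <= m.+1)%N /\
         forall n : nat, `|iter n T h| ^+ 2 = (p.[n%:R])%:C].
Proof.
(* The order m + 1 satisfies the same bounds as a, so the same two lemmas serve both orders. *)
have mm : m%:R < (m.+1%:R : R) <= m.+1%:R by rewrite ltr_nat ltnSn lexx.
tfae.
- move=> Ta; apply: (fdiff_isometry hip hT (m := m)); first by case/andP: mm.
  exact: isometry_fdiff ham Ta.
- move=> Tm h.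
  have [p [sp hp]] := fdiff_poly (isometry_fdiff hip hT mm Tm h).
  by exists p; split=> // n; rewrite (norm_sqE hip) hp.
- move=> hpoly; apply: (fdiff_isometry hip hT (m := m)); first by case/andP: ham.
  move=> h n; have [p [sp hp]] := hpoly h.
  rewrite -[RHS](fdiff_horner_eq0 n sp); congr (iter _ _ _ _).
  by apply/funext => i; apply: complexI; rewrite -hp (norm_sqE hip).
Qed.
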